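(* Let $\lambda_M>0$ be a constant and consider the supplier's maximization problem $$\max_{r\ge 0}\Pi^*_s(r)=\lambda_M\cdot\max_{r\ge 0} r\,\mathbb{E}(\alpha-r)_+ .$$ Assume that the nonnegative demand parameter $\alpha$ has finite mean and follows a continuous (non-atomic) distribution $F$ with support within $L$ and $H$. Then: (a) (Necessary condition) If an optimal price $r^*$ for the supplier exists (i.e. a maximizer of $\Pi^*_s$ over $r\ge 0$), then $r^*$ satisfies the fixed point equation $r^*=\mathrm{m}(r^* )$. (b) (Sufficient conditions) If the generalized mean residual demand function $\ell(r):=\mathrm{m}(r)/r$, $0<r<H$, of $F$ is strictly decreasing and $\mathbb{E}\alpha^2$ is finite, then the supplier's optimal price $r^*$ exists and is the unique solution of $r^*=\mathrm{m}(r^* )$. In this case, $r^*=\mathbb{E}\alpha/2$ if $\mathbb{E}\alpha/2<L$, and $r^*\in[L,H)$ otherwise.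
   Context: Here $(x)_+:=\max\{0,x\}$. The random demand level $\alpha$ is nonnegative with continuous (non-atomic) cdf $F$, $F(0)=0$, and $\mathbb{E}\alpha<\infty$; $\bar F:=1-F$. The bounds of the support are $L=\sup\{r\ge 0:F(r)=0\}$ and $H=\inf\{r\ge 0:F(r)=1\}$, with $0\le L<H\le\infty$ ($H=\infty$ if $F(r)<1$ for all $r$). The support is not assumed to be an interval and $F$ is not assumed to have a density. The mean residual demand (MRD) function of $\alpha$ is $$\mathrm{m}(r):=\mathbb{E}(\alpha-r\mid\alpha>r)=\frac{1}{\bar F(r)}\int_r^\infty\bar F(u)\,du\quad\text{for } r<H,\qquad \mathrm{m}(r):=0\text{ otherwise.}$$ *)

(* Defs.v *)
From mathcomp Require Import all_boot all_order all_algebra.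
From mathcomp Require Import all_classical all_reals all_analysis.
Import Order.TTheory GRing.Theory Num.Theory.
Import numFieldNormedType.Exports.

Set Implicit Arguments.
Unset Strict Implicit.
Unset Printing Implicit Defensive.

Local Open Scope classical_set_scope.
Local Open Scope ring_scope.

(* The cdf F and the survival function 1 - F of alpha are the library's
   [cdf alpha] and [ccdf alpha], with values in \bar R. *)

Definition support_inf (d : measure_display) (T : measurableType d)
    (R : realType) (P : probability T R) (alpha : {RV P >-> R}) : \bar R :=
  ereal_sup [set r%:E | r in [set r : R | 0 <= r /\ cdf alpha r = 0%E]].

(* The infimum of the empty set is +oo, so H = +oo if F < 1 everywhere. *)
Definition support_sup (d : measure_display) (T : measurableType d)
    (R : realType) (P : probability T R) (alpha : {RV P >-> R}) : \bar R :=
  ereal_inf [set r%:E | r in [set r : R | 0 <= r /\ cdf alpha r = 1%E]].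

(* Both extended-real quantities under [fine] are finite when alpha has finite
   mean, which is assumed wherever this function is used. *)
Definition mrd (d : measure_display) (T : measurableType d)
    (R : realType) (P : probability T R) (alpha : {RV P >-> R}) (r : R) : R :=
  if (r%:E < support_sup alpha)%E then
    (fine (ccdf alpha r))^-1 *
      fine (\int[@lebesgue_measure R]_(u in `[r, +oo[) ccdf alpha u)%E
  else 0.

(* Only meaningful for 0 < r < H. *)
Definition gmrd (d : measure_display) (T : measurableType d)
    (R : realType) (P : probability T R) (alpha : {RV P >-> R}) (r : R) : R :=
  mrd alpha r / r.

Definition supplier_profit (d : measure_display) (T : measurableType d)
    (R : realType) (P : probability T R) (alpha : {RV P >-> R})
    (lambdaM r : R) : \bar R :=
  (lambdaM%:E * (r%:E * 'E_P[(fun w => Num.max 0 (alpha w - r))%R]))%E.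

Definition optimal_price (d : measure_display) (T : measurableType d)
    (R : realType) (P : probability T R) (alpha : {RV P >-> R})
    (lambdaM rstar : R) : Prop :=
  0 <= rstar /\
  forall r : R, 0 <= r ->
    (supplier_profit alpha lambdaM r <= supplier_profit alpha lambdaM rstar)%E.

(* Main.v *)
(** Let [g r = E (alpha - r)_+], a convex function whose subgradient at [r] is
    [- P (alpha > r)] and which equals the integral of the survival function
    over [r, +oo[. Inserting the subgradient inequality at a maximizer [r] of
    [s * g s] into [s * g s <= r * g r] gives
    [(s - r) (g r - s P (alpha > r)) <= 0] for all [s >= 0]; letting [s] tend
    to [r] from both sides yields [g r = r P (alpha > r)], i.e. [r = m r],
    without differentiating [g]. For existence, [n (alpha - n)_+ <= alpha ^ 2]
    and dominated convergence give [r * g r --> 0] at infinity. Fixed points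
    of [m] solve [l r = 1], so strict monotonicity makes them unique. Below [L]
    the function [g] is [E alpha - r], whose only fixed point candidate is
    [E alpha / 2]. *)
Require Import Defs.
From mathcomp Require Import all_boot all_order all_algebra.
From mathcomp Require Import all_classical all_reals all_analysis.
From mathcomp Require Import measurable_realfun lra.
Import Order.TTheory GRing.Theory Num.Theory.
Import numFieldNormedType.Exports.

Set Implicit Arguments.
Unset Strict Implicit.
Unset Printing Implicit Defensive.

Local Open Scope classical_set_scope.
Local Open Scope ring_scope.

Definition survival {d : measure_display} {T : measurableType d} {R : realType}
  {P : probability T R} (X : {RV P >-> R}) (r : R) : R := fine (ccdf X r).

(** This is the [g] of the overview, taken real-valued so that convexity arguments become real
    arithmetic. *)
Definition mean_excess {d : measure_display} {T : measurableType d}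
    {R : realType} {P : probability T R} (X : {RV P >-> R}) (r : R) : R :=
  \int[P]_w Num.max 0 (X w - r).

(** * Survival function and bounds of the support *)

Section survival_function.
Context {d : measure_display} {T : measurableType d} {R : realType}.
Context {P : probability T R} (X : {RV P >-> R}).

Lemma survival_cdf r : survival X r = 1 - fine (cdf X r).
Proof. by rewrite /survival ccdf_1_cdf fineB// fin_num_measure. Qed.

Lemma survival_eq1 r : cdf X r = 0%E <-> survival X r = 1.
Proof.
rewrite survival_cdf; split=> [->/=|]; first by rewrite subr0.
move=> h; rewrite -(@fineK _ (cdf X r)) ?fin_num_measure//.
by congr EFin; lra.
Qed.

Lemma survival_eq0 r : cdf X r = 1%E <-> survival X r = 0.
Proof.
rewrite survival_cdf; split=> [->/=|]; first by rewrite subrr.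
move=> h; rewrite -(@fineK _ (cdf X r)) ?fin_num_measure//.
by congr EFin; lra.
Qed.

Lemma survival_ge0 r : 0 <= survival X r.
Proof. exact: fine_ge0. Qed.

Lemma survival_le1 r : survival X r <= 1.
Proof. by rewrite survival_cdf gerBl fine_ge0. Qed.

Lemma survival_nonincreasing r s : r <= s -> survival X s <= survival X r.
Proof.
move=> rs; apply: fine_le; rewrite ?fin_num_measure//.
exact: ccdf_nonincreasing.
Qed.

(** Monotonicity alone yields the weak inequality; [lt_support_sup_mean_excess] makes it strict. *)
Lemma le_support_sup r : 0 < survival X r ->
  (r%:E <= support_sup X)%E.
Proof.
move=> sr; apply: le_ereal_inf_tmp => _ [s [s0 /survival_eq0 ss] <-].
rewrite lee_fin leNgt; apply/negP => sr'.
by have := survival_nonincreasing (ltW sr'); lra.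
Qed.

Lemma lt_support_inf_survival r : (r%:E < support_inf X)%E -> survival X r = 1.
Proof.
rewrite ltNge => /negP rL; apply/eqP; rewrite eq_le survival_le1/=.
rewrite leNgt; apply/negP => sr; apply: rL.
apply: ge_ereal_sup => _ [s [s0 /survival_eq1 ss] <-].
rewrite lee_fin leNgt; apply/negP => rs.
by have := survival_nonincreasing (ltW rs); lra.
Qed.

End survival_function.

(** * Convexity, tail integral and stationarity of the mean excess *)

Section mean_excess_function.
Context {d : measure_display} {T : measurableType d} {R : realType}.
Context {P : probability T R} (X : {RV P >-> R}).
Hypothesis X_int : P.-integrable [set: T] (EFin \o X).

Lemma measurable_excess r :
  measurable_fun [set: T] (fun w => Num.max 0 (X w - r)).
Proof.
apply: (@measurable_maxr _ _ _ setT (cst 0) (fun w => X w - r)) => //.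
by apply: measurable_funB.
Qed.

Lemma integrable_excess r :
  P.-integrable [set: T] (EFin \o (fun w => Num.max 0 (X w - r))).
Proof.
apply: (@le_integrable _ _ _ _ _ _ _ (EFin \o (fun w => `|X w| + `|r|))) => //.
- by apply/measurable_EFinP; exact: measurable_excess.
- move=> w _ /=; rewrite lee_fin ger0_norm ?le_max ?lexx// [leRHS]ger0_norm//.
  rewrite ge_max addr_ge0//= lerD//; first exact: ler_norm.
  by rewrite -normrN ler_norm.
- rewrite (_ : _ \o _ = (fun w => (EFin \o (Num.norm \o X)) w +
                                  (EFin \o cst `|r|%R) w)%E)//.
  apply: integrableD => //; last exact: finite_measure_integrable_cst.
  exact: (integrable_norm X_int).
Qed.

Lemma expectation_excess r :
  ('E_P[(fun w => Num.max 0 (X w - r))%R] = (mean_excess X r)%:E)%E.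
Proof.
by rewrite unlock /mean_excess /Rintegral fineK// integrable_fin_num//;
  exact: integrable_excess.
Qed.

Lemma mean_excess_ge0 r : 0 <= mean_excess X r.
Proof. by apply: Rintegral_ge0 => w _; rewrite le_max lexx. Qed.

(** Integrates a pointwise bound: where [X > r], [X - r - (s - r)] is at most the positive part of
    [X - s]; elsewhere the left side vanishes. *)
Lemma mean_excess_tangent r s :
  mean_excess X r - (s - r) * survival X r <= mean_excess X s.
Proof.
pose A := X @^-1` `]r, +oo[.
have mA : measurable A by exact: measurable_funPTI.
have iA : P.-integrable setT (EFin \o (\1_A : T -> R)).
  exact: integrable_indic.
have sA : survival X r = \int[P]_w \1_A w.
  by rewrite /Rintegral integral_indic// setIT.
have iZ : P.-integrable setT (EFin \o (fun w => (s - r) * \1_A w)).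
  exact: (integrableZl _ _ iA).
rewrite sA -RintegralZl// -RintegralB//; last exact: integrable_excess.
apply: le_Rintegral => //.
- exact: (integrableB _ (integrable_excess r) iZ).
- exact: integrable_excess.
move=> w _; rewrite indicE; case: (boolP (w \in A));
  rewrite ?inE ?notin_setE /A/= in_itv/= andbT => Xr /=.
- have -> : Num.max 0 (X w - r) = X w - r by rewrite max_r// subr_ge0 ltW.
  by rewrite le_max; lra.
- have -> : Num.max 0 (X w - r) = 0.
    by rewrite max_l// subr_le0 leNgt; apply/negP.
  by rewrite le_max; lra.
Qed.

Lemma mean_excess_nonincreasing r s : r <= s ->
  mean_excess X s <= mean_excess X r.
Proof.
move=> rs; have := mean_excess_tangent s r.
have := survival_ge0 X s; nra.
Qed.

(** The subgradients lie between -1 and 0. *)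
Lemma mean_excess_lip r s : `|mean_excess X r - mean_excess X s| <= `|r - s|.
Proof.
wlog rs : r s / r <= s.
  move=> h; have [/h//|/ltW/h] := leP r s.
  by rewrite distrC (distrC s).
rewrite ger0_norm ?subr_ge0 ?mean_excess_nonincreasing//.
rewrite ler0_norm ?subr_le0//.
have := mean_excess_tangent r s.
have := survival_le1 X r; nra.
Qed.

Lemma continuous_mean_excess : continuous (mean_excess X).
Proof.
move=> r; apply/cvgrPdist_le => e e0; near=> s.
by rewrite (le_trans (mean_excess_lip r s))//.
Unshelve. all: by end_near. Qed.

(* Apply [ge0_expectation_ccdf] to [max r X = r + (X - r)_+], whose survival
   function is 1 on [0, r[ and that of [X] on [r, +oo[. *)
Lemma mean_excess_integral (r : R) : 0 <= r ->
  (\int[@lebesgue_measure R]_(u in `[r, +oo[) ccdf X u)%E =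
  (mean_excess X r)%:E.
Proof.
move=> r0.
have mM : measurable_fun setT (fun w => Num.max r (X w)).
  by apply: (@measurable_maxr _ _ _ setT (cst r)).
pose M : {RV P >-> R} := mfun_Sub (mem_set mM).
have ME w : M w = Num.max r (X w) by [].
have : ('E_P[M] = r%:E + (mean_excess X r)%:E)%E.
  rewrite -expectation_excess unlock.
  under eq_integral => w _.
    rewrite ME (_ : Num.max r (X w) = r + Num.max 0 (X w - r)); last first.
      by rewrite addr_maxr addr0 addrC subrK.
    rewrite EFinD; over.
  rewrite integralD//; last exact: integrable_excess; last first.
    exact: finite_measure_integrable_cst.
  by rewrite integral_cst// [X in (_ * X)%E]probability_setT mule1.
rewrite ge0_expectation_ccdf; last by move=> w; rewrite ME le_max r0.
have <- : `[0, r[ `|` `[r, +oo[ = `[0, +oo[%classic.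
  by rewrite -itv_bndbnd_setU ?bnd_simp.
rewrite ge0_integral_setU//=; last 2 first.
- by apply: measurable_funTS; exact: ccdf_measurable.
- apply/disj_setPS => u [] /=; rewrite !in_itv/= andbT => /andP[_ ur] ru.
  by rewrite leNgt ur in ru.
under eq_integral => u.
  rewrite inE/= in_itv/= => /andP[_ ur].
  have -> : ccdf M u = 1%E.
    rewrite /ccdf/= /distribution /pushforward/=.
    rewrite (_ : _ @^-1` _ = setT) ?probability_setT//.
    apply/seteqP; split=> // w _ /=; rewrite in_itv/= andbT.
    by apply: (lt_le_trans ur); rewrite le_max lexx.
  over.
rewrite integral_cst//= mul1e lebesgue_measure_itv/= lte_fin.
under eq_integral => u.
  rewrite inE/= in_itv/= andbT => ru.
  have -> : ccdf M u = ccdf X u.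
    rewrite /ccdf/= /distribution /pushforward/=; congr (P _).
    apply/seteqP; split=> w /=; rewrite !in_itv/= !andbT lt_max.
      by case/orP => // /(le_lt_trans ru); rewrite ltxx.
    by move=> ->; rewrite orbT.
  over.
move=> h.
have {h} : (r%:E + \int[lebesgue_measure]_(x in `[r, +oo[) ccdf X x =
  r%:E + (mean_excess X r)%:E)%E.
  (* The length of [[0, r[] is defined by cases; the degenerate case is [r = 0]. *)
  rewrite -h; congr (_ + _)%E; case: ltP => [_|]; first by rewrite oppr0 adde0.
  by move=> r0'; congr EFin; apply/eqP; rewrite eq_le r0 r0'.
by move/(congr1 (fun z => z - r%:E)%E); rewrite ![(r%:E + _)%E]addeC !addeK.
Qed.

(** If the survival function vanished at [r], it would vanish on the whole tail, and so would its
    integral. *)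
Lemma mean_excess_gt0_survival r : 0 <= r -> 0 < mean_excess X r -> 0 < survival X r.
Proof.
move=> r0 gr; rewrite lt_neqAle survival_ge0 andbT; apply/eqP => /esym sr.
suff : mean_excess X r = 0 by lra.
apply/EFin_inj; rewrite -mean_excess_integral//.
apply: integral0_eq => u /=; rewrite in_itv/= andbT => ru.
rewrite -(@fineK _ (ccdf X u)) ?fin_num_measure//; congr EFin.
apply/eqP; rewrite eq_le survival_ge0 andbT.
by rewrite -sr; exact: survival_nonincreasing.
Qed.

Lemma lt_support_sup_mean_excess r : 0 <= r -> 0 < mean_excess X r ->
  (r%:E < support_sup X)%E.
Proof.
(* As [g] falls with slope at least -1, [g s >= g r / 2 > 0], so survival is still positive at
   [s > r]. *)
move=> r0 gr; pose s := r + mean_excess X r / 2.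
apply: (@lt_le_trans _ _ s%:E); first by rewrite lte_fin /s; lra.
apply: le_support_sup; apply: mean_excess_gt0_survival; first by rewrite /s; lra.
have := mean_excess_tangent r s; have := survival_le1 X r.
have := survival_ge0 X r; rewrite /s; nra.
Qed.

Lemma mrdE r : 0 <= r -> (r%:E < support_sup X)%E ->
  mrd X r = mean_excess X r / survival X r.
Proof. by move=> r0 rH; rewrite /mrd rH mean_excess_integral//= mulrC. Qed.

(** The tangent at [r], of slope -1, taken at 0 gives one inequality; the tangent at 0 taken at [r]
    gives the other. *)
Lemma mean_excess_below_support_inf r : 0 <= r -> (r%:E < support_inf X)%E ->
  mean_excess X r = mean_excess X 0 - r.
Proof.
move=> r0 /lt_support_inf_survival sr.
apply/eqP; rewrite eq_le; apply/andP; split.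
  by have := mean_excess_tangent r 0; rewrite sr; lra.
by have := mean_excess_tangent 0 r; have := survival_le1 X 0; nra.
Qed.

Lemma maximizer_mrd r : 0 <= r -> 0 < r * mean_excess X r ->
  (forall s, 0 <= s -> s * mean_excess X s <= r * mean_excess X r) ->
  r = mrd X r.
Proof.
move=> r0 rg rmax.
have {r0}r0 : 0 < r.
  rewrite lt_neqAle r0 andbT; apply/eqP => r_0.
  by rewrite -r_0 mul0r ltxx in rg.
have gr : 0 < mean_excess X r by rewrite pmulr_rgt0 in rg.
have sr := mean_excess_gt0_survival (ltW r0) gr.
rewrite mrdE ?ltW ?lt_support_sup_mean_excess ?ltW//.
suff -> : mean_excess X r = r * survival X r by rewrite mulfK// gt_eqF.
(* Multiply the tangent inequality by [s] and compare with the maximum at [r]. *)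
have tang s : 0 <= s -> (s - r) * (mean_excess X r - s * survival X r) <= 0.
  move=> s0; have := rmax _ s0; have := mean_excess_tangent r s; nra.
apply/eqP; rewrite eq_le; apply/andP; split; rewrite leNgt; apply/negP => h.
(* An explicit perturbation replaces the limit: at [s = r + e] the second factor of [tang] is half
   the gap, still positive. *)
- pose e := (mean_excess X r - r * survival X r) / survival X r / 2.
  have e0 : 0 < e by rewrite !divr_gt0// subr_gt0.
  have eE : e * survival X r = (mean_excess X r - r * survival X r) / 2.
    by rewrite /e mulrAC divfK// gt_eqF.
  have /tang : 0 <= r + e by lra.
  nra.
- pose e := (r * survival X r - mean_excess X r) / survival X r / 2.
  have e0 : 0 < e by rewrite !divr_gt0// subr_gt0.
  have eE : e * survival X r = (r * survival X r - mean_excess X r) / 2.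
    by rewrite /e mulrAC divfK// gt_eqF.
  (* The price [r - e] is admissible: times the survival at [r] it is half of
     [r * survival X r + mean_excess X r]. *)
  have er : 0 <= r - e by rewrite -(pmulr_lge0 _ sr); nra.
  have := tang _ er; nra.
Qed.

(** Provides a price of positive profit, so every maximizer has positive profit. Continuity at 0
    keeps survival positive at some [e / 2]; the tangent there, taken at [e / 4], is positive. *)
Lemma exists_mean_excess_gt0 : continuous (cdf X) -> cdf X 0 = 0%E ->
  exists2 c, 0 < c & 0 < mean_excess X c.
Proof.
move=> Fc F0.
have /fine_cvg : cdf X r @[r --> 0] --> (fine (cdf X 0))%:E.
  by rewrite fineK ?fin_num_measure//; exact: Fc.
rewrite F0/= => /cvgrPdist_lt/(_ 1 ltr01)[e /= e0 eP].
have : ball 0 e (e / 2).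
  by rewrite /ball/= sub0r normrN gtr0_norm; lra.
move=> /eP; rewrite sub0r normrN ger0_norm ?fine_ge0// => Fe.
exists (e / 4); first by lra.
have : 0 < survival X (e / 2) by rewrite survival_cdf; lra.
have := mean_excess_tangent (e / 2) (e / 4).
have := mean_excess_ge0 (e / 2).
nra.
Qed.

End mean_excess_function.

(** * Decay of the profit and existence of a maximizer *)

Section second_moment.
Context {d : measure_display} {T : measurableType d} {R : realType}.
Context {P : probability T R} (X : {RV P >-> R}).
Hypothesis X_int : P.-integrable [set: T] (EFin \o X).
Hypothesis X2_int : P.-integrable [set: T] (EFin \o (fun w => X w ^+ 2)).

(** Restricted to integers because dominated convergence concerns sequences; each [f_ n w] is 0 once
    [n >= X w]. *)
Lemma mulr_mean_excess_cvg0_nat :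
  n%:R * mean_excess X n%:R @[n --> \oo] --> (0 : R).
Proof.
pose f_ n w := (n%:R * Num.max 0 (X w - n%:R)) : R.
have f_ge0 n w : 0 <= f_ n w by rewrite mulr_ge0// le_max lexx.
have f_le n w : f_ n w <= X w ^+ 2.
  have n0 : 0 <= n%:R :> R by [].
  rewrite /f_; have [Xn|nX] := leP (X w) n%:R.
    by rewrite max_l ?mulr0 ?sqr_ge0// subr_le0.
  by rewrite max_r ?subr_ge0 ?ltW//; nra.
have mf n : measurable_fun setT (EFin \o f_ n).
  apply/measurable_EFinP; apply: measurable_funM => //.
  exact: measurable_excess.
have fE n : (\int[P]_w (EFin \o f_ n) w)%E = (n%:R * mean_excess X n%:R)%:E.
  rewrite EFinM -expectation_excess// unlock -integralZl//.
  exact: integrable_excess.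
have [] := @dominated_convergence _ _ _ P setT measurableT
  (fun n => EFin \o f_ n) (cst 0%E) _ mf _ _ X2_int _.
- exact: measurable_cst.
- apply: aeW => w _ /=; apply: cvg_near_cst; near=> n.
  have Xn : X w <= n%:R by near: n; exact: nbhs_infty_ger.
  by rewrite /f_ max_l ?mulr0// subr_le0.
- by apply: aeW => w n _ /=; rewrite lee_fin ger0_norm.
move=> _ _; rewrite integral0.
rewrite (_ : (fun n => _) = EFin \o (fun n : nat => n%:R * mean_excess X n%:R)).
  by move/fine_cvg.
by apply/funext => n; rewrite fE.
Unshelve. all: by end_near. Qed.

Lemma mulr_mean_excess_small e : 0 < e ->
  exists2 M, 0 <= M & forall r, M <= r -> r * mean_excess X r <= e.
Proof.
move=> e0; have /cvgrPdist_le /(_ (e / 2)) := mulr_mean_excess_cvg0_nat.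
(* With [n] the integer part of [r], [r * g r <= (n + 1) * g n <= 2 * n * g n], hence the bound
   [e / 2]. The threshold [N.+1] ensures [n >= 1]. *)
rewrite divr_gt0// => /(_ isT) [N _ NP]; exists N.+1%:R => // r Nr.
have r0 : 0 <= r by apply: le_trans Nr.
have /andP[nr rn] := truncn_itv r0; set n := Num.truncn r in nr rn.
have Nn : (N < n)%N.
  by rewrite -ltnS -(ltr_nat R) (le_lt_trans Nr).
have := NP n (ltnW Nn); rewrite /= sub0r normrN ger0_norm; last first.
  by rewrite mulr_ge0// mean_excess_ge0.
have n1 : 1 <= n%:R :> R by rewrite ler1n (leq_trans _ Nn).
move: rn; rewrite -natr1 => rn.
have := mean_excess_nonincreasing X_int nr.
have := mean_excess_ge0 X r.
nra.
Qed.

Lemma maximizer_exists c : 0 <= c -> 0 < c * mean_excess X c ->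
  exists r, [/\ 0 <= r, 0 < r * mean_excess X r &
    forall s, 0 <= s -> s * mean_excess X s <= r * mean_excess X r].
Proof.
(* Beyond [M] the profit is at most that at [c], so maximizing over a compact interval containing
   [c] and [M] suffices. *)
move=> c0 gc; have [M M0 MP] := mulr_mean_excess_small gc.
have cM : 0 <= Num.max c M by rewrite le_max c0.
have /(EVT_max cM)[r] :
    {within `[0, Num.max c M], continuous (fun r => r * mean_excess X r)}.
  apply: continuous_subspaceT => r; apply: cvgM; first exact: cvg_id.
  exact: continuous_mean_excess.
rewrite in_itv/= => /andP[r0 _] rmax.
have rc : c * mean_excess X c <= r * mean_excess X r.
  by apply: rmax; rewrite in_itv/= c0 le_max lexx.
exists r; split => //; first exact: lt_le_trans rc.
move=> s s0; have [sM|Ms] := leP s (Num.max c M).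
  by apply: rmax; rewrite in_itv/= s0.
apply: le_trans rc; apply: MP.
by rewrite (le_trans _ (ltW Ms))// le_max lexx orbT.
Qed.

End second_moment.

(** * Integrability from almost sure nonnegativity *)

Section nonnegative.
Context {d : measure_display} {T : measurableType d} {R : realType}.
Context {P : probability T R} (X : {RV P >-> R}).
Hypothesis X_ge0 : {ae P, forall w, 0 <= X w}.

Lemma ae_ge0_integrable : ('E_P[X] < +oo)%E ->
  P.-integrable [set: T] (EFin \o X).
Proof.
rewrite unlock => EX; apply/integrableP; split; first exact/measurable_EFinP.
rewrite (ae_eq_integral (EFin \o X))//; last first.
  by move: X_ge0; apply: filterS => w Xw _ /=; rewrite ger0_norm.
- exact/measurable_EFinP.
- by do 2 apply: measurableT_comp => //.
Qed.

Lemma expectation_mean_excess0 : ('E_P[X] < +oo)%E ->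
  'E_P[X]%E = (mean_excess X 0)%:E.
Proof.
move=> /ae_ge0_integrable X_int; rewrite -expectation_excess// unlock.
apply: ae_eq_integral => //.
- exact/measurable_EFinP.
- by apply/measurable_EFinP; exact: measurable_excess.
- by move: X_ge0; apply: filterS => w Xw _ /=; rewrite subr0 max_r.
Qed.

End nonnegative.

Theorem theorem3p2 (d : measure_display) (T : measurableType d) (R : realType)
    (P : probability T R) (alpha : {RV P >-> R}) (lambdaM : R)
    (lambdaM_gt0 : 0 < lambdaM)
    (alpha_ge0 : {ae P, forall w, 0 <= alpha w})
    (F_continuous : continuous (cdf alpha))
    (F0 : cdf alpha 0 = 0%E)
    (finite_mean : ('E_P[alpha] < +oo)%E) :
  (forall rstar : R,
     optimal_price alpha lambdaM rstar -> rstar = mrd alpha rstar)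
  /\
  ((forall r s : R, 0 < r -> r < s -> (s%:E < support_sup alpha)%E ->
      gmrd alpha s < gmrd alpha r) ->
   ('E_P[(fun w => alpha w ^+ 2)%R] < +oo)%E ->
   exists rstar : R,
     [/\ unique (optimal_price alpha lambdaM) rstar,
         unique (fun r : R => 0 <= r /\ r = mrd alpha r) rstar,
         ('E_P[alpha] * (2^-1)%:E < support_inf alpha)%E ->
           rstar%:E = ('E_P[alpha] * (2^-1)%:E)%E
       & ~ ('E_P[alpha] * (2^-1)%:E < support_inf alpha)%E ->
           (support_inf alpha <= rstar%:E)%E /\
           (rstar%:E < support_sup alpha)%E]).
Proof.
have X_int := ae_ge0_integrable alpha_ge0 finite_mean.
have EX := expectation_mean_excess0 alpha_ge0 finite_mean.
have [c c0 gc] := exists_mean_excess_gt0 X_int F_continuous F0.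
set g := mean_excess alpha in EX gc *.
have g0 : 0 < g 0.
  by apply: lt_le_trans gc _; exact: mean_excess_nonincreasing (ltW c0).
(* The factor [lambdaM > 0] cancels, leaving a real-valued problem. *)
have optE r : optimal_price alpha lambdaM r <->
    0 <= r /\ (forall s, 0 <= s -> s * g s <= r * g r).
  rewrite /optimal_price /supplier_profit.
  by split=> -[r0 rP]; split=> // s /rP;
    rewrite !expectation_excess// -!EFinM lee_fin ler_pM2l.
have opt_gt0 r : optimal_price alpha lambdaM r -> 0 < r * g r.
  by move=> /optE[r0 /(_ _ (ltW c0))]; apply: lt_le_trans; rewrite mulr_gt0.
have opt_mrd r : optimal_price alpha lambdaM r -> r = mrd alpha r.
  move=> ropt; have [r0 rP] := (optE r).1 ropt.
  by apply: maximizer_mrd => //; exact: opt_gt0.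
split=> // ell_decr EX2.
have X2_int : P.-integrable [set: T] (EFin \o (fun w => alpha w ^+ 2)).
  apply/integrableP; split.
    by apply/measurable_EFinP; exact: measurable_funX.
  move: EX2; rewrite unlock; congr (_ < _)%E; apply: eq_integral => w _ /=.
  by rewrite ger0_norm// sqr_ge0.
have [r [r0 rg rmax]] :=
  maximizer_exists X_int X2_int (ltW c0) (mulr_gt0 c0 gc).
have ropt : optimal_price alpha lambdaM r by apply/optE.
(* Zero is no fixed point since [mrd alpha 0 > 0]; at or above [H] the default value 0 of [mrd]
   would force [s = 0]. *)
have fix_lt s : 0 <= s -> s = mrd alpha s ->
    0 < s /\ (s%:E < support_sup alpha)%E.
  move=> s0 sm.
  have sH0 : (0%:E < support_sup alpha)%E by exact: lt_support_sup_mean_excess.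
  have s_gt0 : 0 < s.
    rewrite lt_neqAle s0 andbT; apply/eqP => s_0; move: sm; rewrite -s_0 mrdE//.
    apply/eqP; rewrite lt_eqF// divr_gt0//; exact: mean_excess_gt0_survival.
  split=> //; rewrite ltNge; apply/negP => Hs; move: sm.
  by rewrite /mrd ltNge Hs/= => s_0; rewrite s_0 ltxx in s_gt0.
have fix_gmrd s : 0 < s -> s = mrd alpha s -> gmrd alpha s = 1.
  by move=> s0 sm; rewrite /gmrd -sm divff// gt_eqF.
have fix_uniq : unique (fun r : R => 0 <= r /\ r = mrd alpha r) r.
  split; first by split=> //; exact: opt_mrd.
  move=> s [s0 sm]; have rm := opt_mrd _ ropt.
  have [r_gt0 rH] := fix_lt _ r0 rm; have [s_gt0 sH] := fix_lt _ s0 sm.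
  have [rs|sr|//] := ltgtP r s.
    by have := ell_decr _ _ r_gt0 rs sH; rewrite !fix_gmrd// ltxx.
  by have := ell_decr _ _ s_gt0 sr rH; rewrite !fix_gmrd// ltxx.
have rm := opt_mrd _ ropt; have [_ rH] := fix_lt _ r0 rm.
exists r; split => //.
- split=> // s sopt; apply: fix_uniq.2; split; first exact: sopt.1.
  exact: opt_mrd.
(* Below [L] survival is 1 and [g] is [g 0 - r], so [g 0 / 2] is itself a fixed point. *)
- rewrite EX -EFinM => mL; congr EFin; apply: fix_uniq.2.
  have m0 : 0 <= g 0 / 2 by lra.
  have gm := mean_excess_below_support_inf X_int m0 mL.
  split=> //; rewrite mrdE//.
    by rewrite (lt_support_inf_survival mL) gm -/g divr1; lra.
  by apply: lt_support_sup_mean_excess => //; rewrite gm -/g; lra.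
- rewrite EX -EFinM => mL; split=> //.
  (* A fixed point [r < L] satisfies [r = g 0 - r], which puts [g 0 / 2] below [L]. *)
  rewrite leNgt; apply/negP => rL; apply: mL.
  suff -> : g 0 / 2 = r by [].
  move: (rm); rewrite mrdE// (mean_excess_below_support_inf X_int r0 rL).
  by rewrite (lt_support_inf_survival rL) divr1 -/g; lra.
Qed.
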